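(* With $\beta=q+q^{-1}$, the matrices $A$ and $A^*$ satisfy $$A^3A^*-(\beta+1)A^2A^*A+(\beta+1)AA^*A^2-A^*A^3=q^{N+M-2}(q+1)^2(AA^*-A^*A),$$ $$(A^* )^2A-\beta A^*AA^*+A(A^* )^2=0.$$
   Context: Let $\mathbb F_q$ be a finite field with $q$ elements, let $N,M$ be positive integers, let $H$ be a vector space over $\mathbb F_q$ of dimension $N+M$, and fix a subspace $h\subseteq H$ of dimension $M$. Let $X$ be the set of subspaces $y\subseteq H$ with $y\cap h=0$, partially ordered by inclusion (the Attenuated Space poset $\mathcal A_q(N,M)$). For $y,z\in X$, $z$ covers $y$ when $y\subseteq z$ and $\dim z-\dim y=1$; $y,z$ are adjacent when one of them covers the other. Let $\mathrm{Mat}_X(\mathbb C)$ be the algebra of complex matrices with rows and columns indexed by $X$. The matrix $A\in\mathrm{Mat}_X(\mathbb C)$ has $(y,z)$-entry $1$ if $y$ covers $z$; $q^{\dim y}$ if $z$ covers $y$; and $0$ if $y,z$ are not adjacent. The matrix $A^*\in\mathrm{Mat}_X(\mathbb C)$ is diagonal with $(y,y)$-entry $q^{-\dim y}$ for $y\in X$. *)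

(* Defs.v *)
From HB Require Import structures.
From mathcomp Require Import all_boot all_order all_algebra.
From mathcomp Require Import complex reals.

Set Implicit Arguments.
Unset Strict Implicit.
Unset Printing Implicit Defensive.

Import GRing.Theory.
Local Open Scope ring_scope.

(* [{vspace H}] has no finite-type instance in the library, even over a finite
   field; it is inherited here from the canonical matrix encoding. *)
Section FiniteVspace.
Import VectorInternalTheory.
Variables (F : finFieldType) (H : vectType F).
HB.instance Definition _ := [Countable of {vspace H} by <:].
HB.instance Definition _ := [Finite of {vspace H} by <:].
End FiniteVspace.

Section AttenuatedSpace.

Variables (F : finFieldType) (H : vectType F) (h : {vspace H}).

Definition attenuated : predArgType :=
  {y : {vspace H} | (y :&: h == 0)%VS}.

HB.instance Definition _ := Finite.on attenuated.

Definition att_le (y z : attenuated) : bool := (val y <= val z)%VS.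

Definition att_dim (y : attenuated) : nat := \dim (val y).

(* [covers z y] reads "z covers y"; truncated subtraction is harmless since the
   difference is required to be 1. *)
Definition covers (z y : attenuated) : bool :=
  att_le y z && (att_dim z - att_dim y == 1)%N.

End AttenuatedSpace.

(* MathComp matrices have ordinal indices, so Mat_X(C) is encoded through the
   enumeration of X: row and column [i] stand for the element [enum_val i]. *)
Notation matX R h := 'M[R[i]]_#|{: attenuated h}|.

Section Matrices.

Variables (R : realType) (F : finFieldType) (H : vectType F) (h : {vspace H}).

Notation q := (#|F|%:R : R[i]).

Definition mat_of (f : attenuated h -> attenuated h -> R[i]) : matX R h :=
  \matrix_(i, j) f (enum_val i) (enum_val j).

Definition attA : matX R h :=
  mat_of (fun y z => if covers y z then 1
                     else if covers z y then q ^+ att_dim y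
                     else 0).

Definition attAstar : matX R h :=
  mat_of (fun y z => if y == z then q ^- att_dim y else 0).

End Matrices.

(* Main.v *)
Require Import Defs.
From HB Require Import structures.
From mathcomp Require Import all_boot all_order all_algebra.
From mathcomp Require Import complex reals.
From mathcomp Require Import finfield zify ring.

(* Write A = U + D, where U keeps the entries (y, z) with y covering z and D
   those with z covering y.  Then U A* = q A* U and D A* = q^-1 A* D, which
   gives the second relation at once.  Moving A* to the left in the first one
   and sorting by words in U and D, the words UUU and DDD cancel, and the rest
   reduces to
     DUU = q (q + 1) UDU - q^3 UUD - q^(N+M) (q + 1) U
     DDU = q (q + 1) DUD - q^3 UDD - q^(N+M) (q + 1) D.
   As U^T = A* D, the second identity is the transpose of the first.  Entrywise
   the first is a count of covering relations between y and w with
   dim y = dim w + 1, and such counts all come from one formula: the number of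
   one-step extensions of a subspace a inside b but not inside s, for a
   contained in b and s. *)

Set Implicit Arguments.
Unset Strict Implicit.
Unset Printing Implicit Defensive.

Import GRing.Theory.
Local Open Scope ring_scope.

(** * Counting one-step extensions of a subspace over a finite field *)

Section Steps.

Variables (F : finFieldType) (H : vectType F).
Implicit Types (a b c s z : {vspace H}).
Local Open Scope nat_scope.

(** Vectors are counted in [finvect_type H], an alias of [H] that carries a finite-type
    structure. *)
Lemma card_vspace_finvect a : #|[set v : finvect_type H | v \in a]| = #|F| ^ \dim a.
Proof.
case: H a => T cT a; rewrite cardsE.
exact: (@card_vspace F (finvect_type (Vector.Pack cT)) cT a).
Qed.

Lemma step_eq a c z : (a <= c)%VS -> (c <= z)%VS -> \dim z = (\dim a).+1 ->
  ~~ (c <= a)%VS -> c = z.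
Proof.
move=> ac cz dz ca; apply/eqP; rewrite eqEdim cz dz ltn_neqAle dimvS // andbT.
by apply: contra ca => e; rewrite -(eq_leqif (dimv_leqif_sup ac)).
Qed.

Lemma dim_add_line a v : v \notin a -> \dim (a + <[v]>)%VS = (\dim a).+1.
Proof.
move=> va; rewrite dimv_disjoint_sum.
  rewrite dim_vline; case: eqP va => [->|_ _]; last by rewrite addn1.
  by rewrite mem0v.
apply/eqP; rewrite -subv0; apply/subvP => x; rewrite memv_cap memv0.
case/andP=> xa /vlineP[k xk]; move: xa; rewrite xk.
by have [->|k0] := eqVneq k 0%R; rewrite ?scale0r // rpredZeq (negPf k0) (negPf va).
Qed.

Definition steps a b s : {set {vspace H}} :=
  [set z | [&& (a <= z)%VS, (z <= b)%VS, ~~ (z <= s)%VS & \dim z == (\dim a).+1]].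

(* The vectors v of b outside s are sorted by z = a + <[v]>; each fibre is z \ a. *)
Lemma card_steps a b s : (a <= b)%VS -> (a <= s)%VS ->
  #|steps a b s| * (#|F| ^ (\dim a).+1 - #|F| ^ \dim a) + #|F| ^ \dim (b :&: s)%VS
  = #|F| ^ \dim b.
Proof.
move=> ab as_.
pose V := finvect_type H; pose B := [set v : V | v \in b]; pose S := [set v : V | v \in s].
rewrite -!card_vspace_finvect -/B -(cardsID S B) addnC.
have -> : [set v : V | v \in (b :&: s)%VS] = B :&: S.
  apply/setP=> v; rewrite !inE; exact: (memv_cap (v : H)).
congr (_ + _); rewrite -[RHS]sum1_card.
rewrite (partition_big (fun v : V => (a + <[v : H]>)%VS) (mem (steps a b s))) /=; last first.
  move=> v; rewrite !inE => /andP[vs vb]; rewrite addvSl subv_add ab -memvE vb /=.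
  rewrite subv_add as_ -memvE vs /= dim_add_line //.
  by apply: contra vs => /(subvP as_).
rewrite -sum_nat_const; apply: eq_bigr => z.
rewrite inE => /and4P[az zb zs /eqP dz].
rewrite sum1_card -dz -!card_vspace_finvect.
have -> : #|[set v : V | v \in z]| - #|[set v : V | v \in a]|
   = #|[set v : V | v \in z] :\: [set v : V | v \in a]|.
  by rewrite cardsDS //; apply/subsetP => v; rewrite !inE => /(subvP az).
apply: eq_card => v; rewrite !inE [RHS]unfold_in /= !inE.
apply/andP/andP => [[va vz] | [/andP[vs vb] /eqP <-]].
  have e : (a + <[v : H]>)%VS = z.
    apply: step_eq dz _; rewrite ?addvSl // subv_add ?az -?memvE //.
    by rewrite subvv.
  rewrite e eqxx (subvP zb) // andbT; split=> //.
  by apply: contra zs => vs; rewrite -e subv_add as_ -memvE.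
split; last exact: (subvP (addvSr a _) _ (memv_line _)).
by apply: contra vs => /(subvP as_).
Qed.

End Steps.

Lemma sum_bool (T : finType) (P : pred T) : (\sum_x P x)%N = #|[set x | P x]|.
Proof. by rewrite -sum1dep_card [RHS]big_mkcond; apply: eq_bigr => x _; case: (P x). Qed.

Lemma sum_bool1 (T : finType) (P : pred T) x0 :
  (forall x, P x = (x == x0)) -> (\sum_x P x)%N = 1%N.
Proof. by move=> e; rewrite sum_bool -(cards1 x0); apply: eq_card => x; rewrite !inE e. Qed.

(** * Covering relations and short intervals in the attenuated space poset *)

Section Attenuated.

Variables (F : finFieldType) (H : vectType F) (h : {vspace H}).
Implicit Types (y z u v w : attenuated h) (a b s : {vspace H}).
Local Open Scope nat_scope.
Local Notation q := #|F|.

Lemma att_cap0 y : (val y :&: h)%VS = 0%VS.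
Proof. exact/eqP/(valP y). Qed.

Lemma coversE z y :
  covers z y = (val y <= val z)%VS && (\dim (val z) == (\dim (val y)).+1).
Proof. by rewrite /covers /att_le /att_dim; case: (_ <= _)%VS => //=; lia. Qed.

Lemma covers_dim z y : covers z y -> \dim (val z) = (\dim (val y)).+1.
Proof. by rewrite coversE => /andP[_ /eqP]. Qed.

Lemma covers_sub z y : covers z y -> (val y <= val z)%VS.
Proof. by case/andP. Qed.

Lemma sub_att y a : (a <= val y)%VS -> (a :&: h == 0)%VS.
Proof. by move=> ay; rewrite -subv0 -(att_cap0 y) capvS. Qed.

(** By the modular law the intersection is [a + (y :&: h)], and [y] avoids [h]. *)
Lemma cap_add_att y a : (a <= val y)%VS -> (val y :&: (a + h) = a)%VS.
Proof. by move=> ay; rewrite capvC -vspace_modl // capvC att_cap0 addv0. Qed.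

(** By the modular law [(y + h) :&: a] equals [y + (h :&: a)], which lies between [y] and [a] and so
    is one of the two. It is [y] exactly when [a] avoids [h], and [a] exactly when [a] lies in
    [y + h]. *)
Lemma step_att y a : (val y <= a)%VS -> \dim a = (\dim (val y)).+1 ->
  (a :&: h == 0)%VS = ~~ (a <= val y + h)%VS.
Proof.
move=> ya da; have modE : (val y + h :&: a = (val y + h) :&: a)%VS by rewrite vspace_modl.
apply/idP/idP => [/eqP a0 | na].
  apply/negP => /capv_idPr; rewrite -modE capvC a0 addv0 => e.
  by move: da; rewrite -e; lia.
apply: contraR na => a0.
rewrite -(@step_eq _ _ (val y) (val y + h :&: a)%VS a) ?addvSl //.
- by rewrite modE capvSl.
- by rewrite subv_add ya capvSr.
apply: contra a0 => /subvP e; rewrite -subv0 -(att_cap0 y) subv_cap capvSr andbT.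
by apply/subvP => x; rewrite capvC => xh; apply/e/(subvP (addvSr _ _)).
Qed.

(** As [s] contains [y + h], [step_att] puts every one-step extension of [y] outside [s] into the
    poset, so [card_steps] already counts poset elements. *)
Lemma card_covers y b s : (val y <= b)%VS -> (val y + h <= s)%VS ->
  #|[set z | [&& covers z y, (val z <= b)%VS & ~~ (val z <= s)%VS]]|
    * (q ^ (\dim (val y)).+1 - q ^ \dim (val y)) + q ^ \dim (b :&: s)%VS = q ^ \dim b.
Proof.
move=> yb ys; rewrite -(card_steps yb (subv_trans (addvSl _ _) ys)).
congr (_ * _ + _); rewrite -(card_imset _ val_inj); apply: eq_card => a.
rewrite inE; apply/imsetP/and4P => [[z + ->] | [ya ab as_ da]].
  by rewrite inE coversE => /and3P[/andP[-> ->] -> ->].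
have aX : (a :&: h == 0)%VS.
  rewrite (step_att ya (eqP da)); apply: contra as_ => e; exact: subv_trans ys.
by exists (Sub a aX : attenuated h) => //; rewrite inE coversE /= ya da ab as_.
Qed.

(** Take [b = y] and [s = v + h] in [card_covers]: every middle [u] lies outside [v + h], and [y]
    meets [v + h] in [v]. With d the dimension of [v], the number of [u] times q^(d+1) - q^d is
    q^(d+2) - q^d. *)
Lemma card_interval y v : (val v <= val y)%VS -> \dim (val y) = (\dim (val v)).+2 ->
  \sum_u (covers y u && covers u v) = q.+1.
Proof.
move=> vy dy; have q1 := card_finNzRing_gt1 F.
rewrite sum_bool.
have -> : [set u | covers y u && covers u v]
  = [set u | [&& covers u v, (val u <= val y)%VS & ~~ (val u <= val v + h)%VS]].
  apply/setP => u; rewrite !inE; case uv: (covers u v); rewrite ?andbF //= andbT.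
  rewrite -(step_att (covers_sub uv) (covers_dim uv)) (valP u) andbT.
  by rewrite coversE dy (covers_dim uv) eqxx andbT.
have := card_covers vy (subvv _); rewrite cap_add_att // dy.
set n := #|_|; rewrite !expnS.
have : 0 < q ^ \dim (val v) by rewrite expn_gt0 ltnW.
(* Writing q as p + 1 turns the truncated difference [q * E - E] into [p * E], which can be
   cancelled. *)
move: (q ^ _) => E E0; case: q q1 => // p p0.
rewrite -{2}[E]mul1n -mulnBl subn1 /= => e.
have pE0 : 0 < p * E by rewrite muln_gt0 E0 andbT; lia.
apply/eqP; rewrite -(eqn_pmul2r pE0).
by apply/eqP; move: e; nia.
Qed.

Definition att_of a (a0 : (a :&: h == 0)%VS) : attenuated h := Sub a a0.

Lemma val_att_of a (a0 : (a :&: h == 0)%VS) : val (att_of a0) = a.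
Proof. by []. Qed.

Lemma covers_join u w z : u != w -> covers z u -> covers z w ->
  (val u + val w)%VS = val z.
Proof.
move=> uw zu zw; have := covers_dim zu; rewrite (covers_dim zw) => -[dwu].
apply: step_eq (covers_dim zu) _; first exact: addvSl.
  by rewrite subv_add !covers_sub.
apply: contra uw; rewrite subv_add subvv /= => wu.
by rewrite -val_eqE eq_sym eqEdim wu -dwu /=.
Qed.

Lemma covers_meet_dim u w z : u != w -> covers z u -> covers z w ->
  \dim (val w) = (\dim (val u :&: val w)%VS).+1.
Proof.
move=> uw zu zw; have := dimv_sum_cap (val u) (val w).
rewrite (covers_join uw zu zw) (covers_dim zu).
have := covers_dim zu; have := covers_dim zw; lia.
Qed.

(** Any common cover has to be [u + w]. *)
Lemma covers_upper u w z v : u != w -> covers z u -> covers z w ->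
  covers v u && covers v w = (v == z).
Proof.
move=> uw zu zw; apply/andP/eqP => [[vu vw]|->//].
by apply: val_inj; rewrite -(covers_join uw zu zw) -(covers_join uw vu vw).
Qed.

(** The only candidate is [u :&: w]: it has codimension 1 in both by the dimension formula, and
    avoids [h] as a subspace of [u]. *)
Lemma covers_lower u w z : u != w -> covers z u -> covers z w ->
  \sum_v (covers u v && covers w v) = 1.
Proof.
move=> uw zu zw; have dw := covers_meet_dim uw zu zw.
have e0 := sub_att (capvSl (val u) (val w)).
apply: (@sum_bool1 _ _ (att_of e0)) => v.
rewrite !coversE -val_eqE val_att_of eqEdim.
have du : \dim (val u) = \dim (val w).
  by have := covers_dim zu; rewrite (covers_dim zw) => -[].
rewrite subv_cap du dw !eqSS; apply/idP/idP => [/andP[/andP[-> /eqP ->] /andP[-> _]]|].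
  by rewrite leqnn.
case/andP=> /andP[vu vw] le; rewrite vu vw andbb eqn_leq le /=.
by apply: dimvS; rewrite subv_cap vu vw.
Qed.

(** * Counts of three-step paths between [y] and [w] *)

Lemma sum_interval y v : \sum_u (covers y u && covers u v)
  = q.+1 * ((val v <= val y)%VS && (\dim (val y) == (\dim (val v)).+2)).
Proof.
case: andP => [[vy /eqP dy]|n]; first by rewrite card_interval // muln1.
rewrite muln0 big1 // => u _; apply/eqP; rewrite eqb0; apply/negP => /andP[yu uv]; apply: n.
by rewrite (covers_dim yu) (covers_dim uv) (subv_trans (covers_sub uv) (covers_sub yu)).
Qed.

(* If u != w then v = y; such u are counted through the subspaces u :&: w, each
   of which has q + 1 extensions inside y, one of them being w. *)
Lemma sum_cross_covers y w : covers y w ->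
  \sum_u \sum_v (covers y u * (covers v u && covers v w))
  = \sum_v covers v w + q * \sum_v covers w v.
Proof.
move=> yw; rewrite (bigD1 w) //=; congr (_ + _).
  by apply: eq_bigr => v _; rewrite yw andbb mul1n.
transitivity (\sum_(u | u != w) \sum_v covers w v * (covers y u && covers u v)).
  apply: eq_bigr => u uw; case yu: (covers y u); last first.
    by rewrite !big1 // => v _; rewrite muln0.
  rewrite -big_distrr /= (@sum_bool1 _ _ y); last by move=> v; apply: covers_upper.
  rewrite muln1 -[LHS](covers_lower uw yu yw).
  by apply: eq_bigr => v _; rewrite mulnb andbC.
rewrite exchange_big big_distrr /=; apply: eq_bigr => v _.
rewrite -big_distrr /= mulnC; case wv: (covers w v); rewrite ?muln0 // !muln1.
apply/eqP; rewrite -eqSS -(card_interval (y := y) (v := v)).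
- by rewrite [X in _ == X](bigD1 w) //= yw wv.
- exact: subv_trans (covers_sub wv) (covers_sub yw).
- by rewrite (covers_dim yw) (covers_dim wv).
Qed.

(* In the only nonzero case y :&: w has codimension 1 in w, u is one of its q + 1
   extensions inside y, and v = u + w.  If y + w meets h, exactly one of these u
   gives a v that meets h. *)
Lemma sum_cross_noncover y w : \dim (val y) = (\dim (val w)).+1 ->
  ~~ (val w <= val y)%VS ->
  \sum_u \sum_v (covers y u * (covers v u && covers v w))
  = q * (\sum_v (covers w v && (val v <= val y)%VS))
    + \sum_u (covers u y && (val w <= val u)%VS).
Proof.
move=> dy wy; have q1 := card_finNzRing_gt1 F.
have yw u : covers y u -> u != w.
  by move=> yu; apply: contra wy => /eqP <-; apply: covers_sub.
have ltdim : \dim (val y :&: val w) < \dim (val w).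
  rewrite ltnNge; apply: contra wy => le.
  have /eqP <- : ((val y :&: val w)%VS == val w) by rewrite eqEdim capvSr.
  exact: capvSl.
have dimsum := dimv_sum_cap (val y) (val w).
have join u : covers u y -> (val w <= val u)%VS -> (val y + val w)%VS = val u.
  move=> uy wu; apply: step_eq (covers_dim uy) _; first exact: addvSl.
    by rewrite subv_add wu covers_sub.
  by rewrite subv_add negb_and wy orbT.
(* When [y :&: w] has codimension above 1 in [w], no path of any of the three kinds exists and all
   sums vanish. *)
have [dw|dw] := eqVneq (\dim (val w)) (\dim (val y :&: val w)%VS).+1; last first.
  have nU u : covers u y -> (val w <= val u)%VS -> False.
    move=> uy wu; move: dimsum; rewrite (join u) // (covers_dim uy); move: dw; lia.
  have nP u : covers w u -> (val u <= val y)%VS -> False.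
    move=> wu uy; have : (val u <= val y :&: val w)%VS by rewrite subv_cap uy covers_sub.
    by move/dimvS; have := covers_dim wu; move: dw; lia.
  have nS u v : covers y u -> covers v u -> covers v w -> False.
    move=> yu vu vw; have := covers_meet_dim (yw _ yu) vu vw.
    have := dimvS (capvS (covers_sub yu) (subvv (val w))); move: dw; lia.
  rewrite !big1 ?muln0 // => u _.
  - by apply/eqP; rewrite eqb0; apply/negP => /andP[]; apply: nU.
  - by apply/eqP; rewrite eqb0; apply/negP => /andP[]; apply: nP.
  - by rewrite big1 // => v _; apply/eqP; rewrite mulnb eqb0; apply/negP => /and3P[]; apply: nS.
pose v0 := att_of (sub_att (capvSl (val y) (val w))).
have -> : \sum_v (covers w v && (val v <= val y)%VS) = 1.
  apply: (@sum_bool1 _ _ v0) => v; rewrite -val_eqE val_att_of eqEdim coversE subv_cap dw eqSS.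
  apply/idP/idP => [/andP[/andP[-> /eqP ->] ->]|/andP[/andP[vy vw] le]] //=.
  rewrite vw vy andbT /= eqn_leq le /=; apply: dimvS; by rewrite subv_cap vy vw.
have v0y : (val v0 <= val y)%VS by apply: capvSl.
have v0w : (val v0 <= val w)%VS by apply: capvSr.
have := card_covers v0y (addvS v0w (subvv h)).
set S := [set _ | _] => cS.
have dv0 : \dim (val w) = (\dim (val v0)).+1 by [].
(* The only possible [v] is [u + w]; by [step_att] over [w] it belongs to the poset exactly when [u]
   is not inside [w + h]. *)
have cross u : \sum_v (covers y u * (covers v u && covers v w)) =
    [&& covers u v0, (val u <= val y)%VS & ~~ (val u <= val w + h)%VS].
  rewrite -big_distrr /=; case yu: (covers y u); last first.
    rewrite mul0n; apply/esym/eqP; rewrite eqb0; apply: contraFN yu => /and3P[uv uy _].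
    by rewrite coversE uy (covers_dim uv) dy dv0 /=.
  rewrite mul1n (covers_sub yu) andTb.
  have le : (val u :&: val w <= val v0)%VS := capvS (covers_sub yu) (subvv _).
  have du : \dim (val u) = \dim (val w) by have := covers_dim yu; rewrite dy => -[].
  have join_meet v : covers v u -> covers v w -> (val u :&: val w)%VS = val v0.
    move=> vu vw; have dm := covers_meet_dim (yw _ yu) vu vw.
    by apply/eqP; rewrite eqEdim le -ltnS -dm dv0 leqnn.
  have [/andP[uv nu]|n] := boolP (covers u v0 && ~~ (val u <= val w + h)%VS); last first.
    rewrite big1 // => v _; apply/eqP; rewrite eqb0; apply: contra n => /andP[vu vw].
    rewrite coversE -{1}(join_meet v) // capvSl du dv0 eqxx /=.
    have := valP v; rewrite (step_att (covers_sub vw) (covers_dim vw)).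
    by rewrite -(covers_join (yw _ yu) vu vw) subv_add addvSl andbT.
  have e : (val u :&: val w)%VS = val v0.
    by apply/eqP; rewrite eqEsubv le subv_cap (covers_sub uv) v0w.
  have dj : \dim (val u + val w) = (\dim (val w)).+1.
    by have := dimv_sum_cap (val u) (val w); rewrite e du dv0 -addSnnS => /addIn.
  have jX : ((val u + val w) :&: h == 0)%VS.
    by rewrite (step_att _ dj) ?addvSr // subv_add negb_and nu.
  apply: (@sum_bool1 _ _ (att_of jX)) => v; apply: covers_upper.
  - exact: yw.
  - by rewrite coversE val_att_of addvSl dj du eqxx.
  - by rewrite coversE val_att_of addvSr dj eqxx.
have -> : \sum_u \sum_v (covers y u * (covers v u && covers v w)) = #|S|.
  by rewrite -sum_bool; apply: eq_bigr => u _; apply: cross.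
have E0 : 0 < q ^ \dim (val v0) by rewrite expn_gt0 ltnW.
(* [Q] tells whether [y + w] avoids [h]. With [E] cancelled, [cS] reads #|S| (q - 1) = q^2 - 1 if it
   does and q^2 - q if not, so #|S| is q + 1 or q. *)
suff [Q [-> cQ]] : exists Q : bool, \sum_u (covers u y && (val w <= val u)%VS) = Q
    /\ \dim (val y :&: (val w + h)) = \dim (val v0) + ~~ Q.
  rewrite muln1; move: cS; rewrite cQ dy dw expnD !expnS /= -/(val v0).
  rewrite [\dim (val y :&: val w)]/(\dim (val v0)).
  move: (q ^ _) E0 => E E0; case: q q1 => // p p0.
  rewrite -{2}[E]mul1n -mulnBl subn1 /= => e.
  have pE0 : 0 < p * E by rewrite muln_gt0 E0 andbT; lia.
  apply/eqP; rewrite -(eqn_pmul2r pE0); apply/eqP; move: e.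
  by case: Q {cQ}; rewrite /= ?expn0 ?expn1 => e; nia.
exists ((val y + val w) :&: h == 0)%VS.
have dj : \dim (val y + val w) = (\dim (val y)).+1 by lia.
have [jX|njX] := boolP ((val y + val w) :&: h == 0)%VS; split.
- apply: (@sum_bool1 _ _ (att_of jX)) => u.
  apply/andP/eqP => [[uy wu]|->]; first by apply: val_inj; rewrite -(join u).
  by rewrite coversE val_att_of addvSl addvSr dj eqxx.
(* Here [y + w] is in the poset and meets [w + h] in [w], so [y] meets [w + h] in [y :&: w]. *)
- rewrite addn0; have := cap_add_att (y := att_of jX) (addvSr (val y) (val w)).
  rewrite val_att_of => e; rewrite val_att_of -{2}e capvA.
  by rewrite (capv_idPl (addvSl (val y) (val w))).
- rewrite big1 // => u _; apply/eqP; rewrite eqb0; apply: contra njX => /andP[uy wu].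
  by rewrite (join _ uy wu) att_cap0.
(* Here [y + w] lies in [y + h], so [y + (w + h) = y + h] and the dimension formula gives
   [y :&: (w + h)] the dimension of [w]. *)
- have := dimv_sum_cap (val y) (val w + h); rewrite addvA addvC.
  rewrite (step_att _ dj) ?addvSl // negbK in njX.
  have -> : (h + (val y + val w) = val y + h)%VS.
    by apply/eqP; rewrite eqEsubv subv_add addvSr njX addvC addvS ?addvSl.
  rewrite !dimv_disjoint_sum ?att_cap0 // dy dv0 /=; lia.
Qed.

Lemma card_covers_above y :
  (\sum_z covers z y) * (q ^ (\dim (val y)).+1 - q ^ \dim (val y))
    + q ^ (\dim (val y) + \dim h) = q ^ \dim {: H}.
Proof.
rewrite -(card_covers (subvf (val y)) (subvv (val y + h)%VS)) (capv_idPr (subvf _)).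
rewrite dimv_disjoint_sum ?att_cap0 // sum_bool; congr (_ * _ + _).
apply: eq_card => z; rewrite !inE subvf /=.
case zy: (covers z y) => //=.
by rewrite -(step_att (covers_sub zy) (covers_dim zy)) (valP z).
Qed.

(** All terms vanish unless dim y = dim w + 1; then the two cross counts apply. If [w] lies in [y],
    the constant term is the difference between the numbers of covers of [w] and of [y]; the factor
    q^(dim y) avoids the exponent dim H - dim y. *)
Lemma card_cross y w :
  (\sum_u \sum_v (covers y u * (covers v u && covers v w))) * q ^ \dim (val y)
  = q ^ \dim {: H} * covers y w + q ^ \dim (val y) *
     (q * (\sum_v covers w v * ((val v <= val y)%VS && (\dim (val y) == (\dim (val v)).+2)))
     + \sum_u covers u y * ((val w <= val u)%VS && (\dim (val u) == (\dim (val w)).+2))).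
Proof.
have q1 := card_finNzRing_gt1 F.
have [dy|dy] := eqVneq (\dim (val y)) (\dim (val w)).+1; last first.
  have S0 u v : covers y u -> covers v u -> covers v w -> False.
    move=> yu vu vw; move: (covers_dim yu) (covers_dim vu) (covers_dim vw) dy; lia.
  have P0 u : covers w u -> \dim (val y) = (\dim (val u)).+2 -> False.
    by move=> wu; move: (covers_dim wu) dy; lia.
  have Q0 u : covers u y -> \dim (val u) = (\dim (val w)).+2 -> False.
    by move=> uy; move: (covers_dim uy) dy; lia.
  have -> : covers y w = false by rewrite coversE (negPf dy) andbF.
  rewrite !big1 ?muln0 // => u _.
  - by apply/eqP; rewrite mulnb eqb0; apply/negP => /and3P[uy _ /eqP]; apply: Q0.
  - by apply/eqP; rewrite mulnb eqb0; apply/negP => /and3P[uy _ /eqP]; apply: P0.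
  - by rewrite big1 // => v _; apply/eqP; rewrite mulnb eqb0; apply/negP => /and3P[]; apply: S0.
have -> : \sum_v covers w v * ((val v <= val y)%VS && (\dim (val y) == (\dim (val v)).+2))
    = \sum_v (covers w v && (val v <= val y)%VS).
  apply: eq_bigr => v _; rewrite mulnb; congr nat_of_bool; case wv: (covers w v) => //=.
  by rewrite dy (covers_dim wv) eqxx andbT.
have -> : \sum_u covers u y * ((val w <= val u)%VS && (\dim (val u) == (\dim (val w)).+2))
    = \sum_u (covers u y && (val w <= val u)%VS).
  apply: eq_bigr => v _; rewrite mulnb; congr nat_of_bool; case wv: (covers v y) => //=.
  by rewrite (covers_dim wv) dy eqxx andbT.
have [wy|wy] := boolP (val w <= val y)%VS; last first.
  rewrite sum_cross_noncover // mulnC.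
  by have -> : covers y w = false; rewrite ?coversE ?(negPf wy) // muln0.
have yw : covers y w by rewrite coversE wy dy eqxx.
rewrite sum_cross_covers // yw muln1.
have -> : \sum_v (covers w v && (val v <= val y)%VS) = \sum_v covers w v.
  apply: eq_bigr => v _; case wv: (covers w v) => //=.
  by rewrite (subv_trans (covers_sub wv) wy).
have -> : \sum_u (covers u y && (val w <= val u)%VS) = \sum_u covers u y.
  apply: eq_bigr => v _; case vy: (covers v y) => //=.
  by rewrite (subv_trans wy (covers_sub vy)).
have := card_covers_above y; have := card_covers_above w.
rewrite dy addSn !expnS.
set a := \sum_v covers v w; set b := \sum_v covers v y; set m := \sum_v covers w v.
have : 0 < q ^ \dim (val w) by rewrite expn_gt0 ltnW.
move: (q ^ \dim (val w)) (q ^ (_ + _)) (q ^ \dim {: H}) => E T B E0; case: q q1 => // p p0.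
have -> : p.+1 * E - E = p * E by rewrite mulSn addKn.
have -> : p.+1 * (p.+1 * E) - p.+1 * E = p * (p.+1 * E) by rewrite mulSn addKn.
move=> ea eb.
(* Subtracting the count above [y] from q times the count above [w] eliminates [T]. *)
suff : p * (a * (p.+1 * E)) = p * (B + b * (p.+1 * E)).
  by move/eqP; rewrite eqn_pmul2l // => /eqP; lia.
have ea' : p.+1 * (a * (p * E) + T) = p.+1 * B by rewrite ea.
by lia.
Qed.

(** For fixed [v] the sum over [u] runs through an interval of length two, whence the factor q +
    1. *)
Lemma sum_lower y w :
  \sum_v \sum_u covers y u * covers u v * covers w v
  = q.+1 * \sum_v covers w v * ((val v <= val y)%VS && (\dim (val y) == (\dim (val v)).+2)).
Proof.
rewrite big_distrr; apply: eq_bigr => v _; rewrite -big_distrl /=.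
have := sum_interval y v; under eq_bigr do rewrite -mulnb.
by move=> ->; rewrite -mulnA; congr (_ * _); rewrite mulnC.
Qed.

Lemma sum_upper y w :
  \sum_v \sum_u covers u y * covers u v * covers v w
  = q.+1 * \sum_u covers u y * ((val w <= val u)%VS && (\dim (val u) == (\dim (val w)).+2)).
Proof.
rewrite exchange_big big_distrr; apply: eq_bigr => u _ /=.
under eq_bigr do rewrite -mulnA mulnb.
by rewrite -big_distrr /= sum_interval mulnCA.
Qed.

(** The entrywise relation between the words UDU, UUD and DUU, arranged without subtraction.
    Multiplying [card_cross] by q + 1 turns its last two sums into path counts. *)
Lemma cross_identity y w :
  q.+1 * (\sum_v \sum_u covers y u * covers v u * covers v w) * q ^ \dim (val y)
  = q.+1 * (q ^ \dim {: H} * covers y w)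
    + q ^ \dim (val y) * (q * (\sum_v \sum_u covers y u * covers u v * covers w v)
                         + \sum_v \sum_u covers u y * covers u v * covers v w).
Proof.
rewrite exchange_big.
under eq_bigr do under eq_bigr do rewrite -mulnA mulnb.
rewrite -mulnA card_cross sum_lower sum_upper; lia.
Qed.

End Attenuated.

(** * The two relations derived from weighted commutation with K *)

Section MatrixRelations.

Variables (C : fieldType) (n : nat) (q c : C) (U D K KV : 'M[C]_n).
Hypothesis q0 : q != 0.
Hypothesis UK : U *m K = q *: (K *m U).
Hypothesis DK : D *m K = q^-1 *: (K *m D).
Hypothesis KVK : KV *m K = 1%:M.
Hypothesis trU : U^T = K *m D.
Hypothesis trKV : KV^T = KV.
Hypothesis duu : D *m U *m U = (q * (q + 1)) *: (U *m D *m U) - q ^+ 3 *: (U *m U *m D)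
  - (q ^+ 2 * c * (q + 1)) *: U.

Lemma tr_raising : D^T = U *m KV.
Proof.
have -> : D = KV *m U^T by rewrite trU mulmxA KVK mul1mx.
by rewrite trmx_mul trmxK trKV.
Qed.

(** Transposing [duu] turns each word into K times the reversed word with U and D swapped; the
    invertible K then cancels. *)
Lemma raising_raising_lowering_rel :
  D *m D *m U = (q * (q + 1)) *: (D *m U *m D) - q ^+ 3 *: (U *m D *m D)
  - (q ^+ 2 * c * (q + 1)) *: D.
Proof.
have KKV : K *m KV = 1%:M by apply: mulmx1C.
(* The weights q and q^-1 cancel, so UD and DU commute with K. *)
have UDK : U *m D *m K = K *m U *m D.
  by rewrite -mulmxA DK -scalemxAr mulmxA UK -scalemxAl scalerA mulVf // scale1r.
have DUK : D *m U *m K = K *m D *m U.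
  by rewrite -mulmxA UK -scalemxAr mulmxA DK -scalemxAl scalerA divff // scale1r.
have e1 : (D *m U *m U)^T = K *m (D *m D *m U).
  rewrite !trmx_mul tr_raising trU !mulmxA -(mulmxA (K *m D) K D) -(mulmxA (K *m D)) -!mulmxA.
  congr (_ *m (_ *m _)).
  by rewrite (mulmxA D U KV) (mulmxA K) (mulmxA K D U) -DUK -mulmxA KKV mulmx1.
have e2 : (U *m D *m U)^T = K *m (D *m U *m D).
  by rewrite !trmx_mul tr_raising trU !mulmxA -(mulmxA _ KV K) KVK mulmx1.
have e3 : (U *m U *m D)^T = K *m (U *m D *m D).
  by rewrite !trmx_mul tr_raising trU !mulmxA -(mulmxA _ KV K) KVK mulmx1 UDK.
have tr_comb a b (X Y Z : 'M[C]_n) : (a *: X - b *: Y - (q ^+ 2 * c * (q + 1)) *: Z)^T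
    = a *: X^T - b *: Y^T - (q ^+ 2 * c * (q + 1)) *: Z^T.
  by apply/matrixP => i j; rewrite !mxE.
have /= := congr1 (fun M => KV *m M^T) duu.
rewrite tr_comb e1 e2 e3 trU !scalemxAr -!mulmxBr !mulmxA KVK !mul1mx.
by rewrite -!mulmxA.
Qed.

(** UUU and DDD drop out because q and q^-1 are roots of x^3 - (q + q^-1 + 1) x^2 + (q + q^-1 + 1) x
    - 1 = (x - 1)(x - q)(x - q^-1). *)
Lemma tridiagonal_sum (A : 'M[C]_n := U + D) :
  A *m A *m A *m K - (q + q^-1 + 1) *: (A *m A *m K *m A)
    + (q + q^-1 + 1) *: (A *m K *m A *m A) - K *m A *m A *m A
  = (c * (q + 1) ^+ 2) *: (A *m K - K *m A).
Proof.
(* Moving K to the left past A replaces A by [A'], so the claim reduces to an identity in U and D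
   alone. *)
pose A' : 'M[C]_n := q *: U + q^-1 *: D.
have AK : A *m K = K *m A' by rewrite mulmxDl UK DK mulmxDr -!scalemxAr.
have core : A' *m A' *m A' - (q + q^-1 + 1) *: (A' *m A' *m A)
    + (q + q^-1 + 1) *: (A' *m A *m A) - A *m A *m A = (c * (q + 1) ^+ 2) *: (A' - A).
  rewrite /A /A' !(mulmxDl, mulmxDr, =^~ scalemxAl, =^~ scalemxAr) duu raising_raising_lowering_rel.
  move: (U *m U *m U) (U *m U *m D) (U *m D *m U) (U *m D *m D) => UUU UUD UDU UDD.
  move: (D *m U *m D) (D *m D *m D) => DUD DDD.
  by apply/matrixP => i j; rewrite !mxE; field.
have -> : A *m A *m A *m K = K *m (A' *m A' *m A').
  by rewrite -(mulmxA (A *m A)) AK mulmxA -(mulmxA A A) AK !mulmxA AK.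
have -> : A *m A *m K *m A = K *m (A' *m A' *m A).
  by rewrite -(mulmxA A A) AK !mulmxA AK.
have distr a (X Y Z W : 'M[C]_n) : K *m (X - a *: Y + a *: Z - W)
    = K *m X - a *: (K *m Y) + a *: (K *m Z) - K *m W.
  by rewrite !(mulmxDr, mulmxN) -!scalemxAr.
by rewrite AK -mulmxBr [RHS]scalemxAr -core distr !mulmxA.
Qed.

(** The coefficients of KKU and KKD are the values of x^2 - (q + q^-1) x + 1 at its roots q and
    q^-1. *)
Lemma quadratic_sum (A : 'M[C]_n := U + D) :
  K *m K *m A - (q + q^-1) *: (K *m A *m K) + A *m K *m K = 0.
Proof.
have -> : A *m K *m K = q ^+ 2 *: (K *m K *m U) + q ^- 2 *: (K *m K *m D).
  rewrite !mulmxDl UK DK -!scalemxAl -!mulmxA UK DK -!scalemxAr !scalerA !mulmxA.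
  by rewrite -invfM.
rewrite -(mulmxA K A K) mulmxDl UK DK !mulmxDr -!scalemxAr !mulmxA.
move: (K *m K *m U) (K *m K *m D) => KU KD.
by apply/matrixP => i j; rewrite !mxE; field.
Qed.

End MatrixRelations.

(** Here x is q, E is q^(dim y), B is q^(dim H), k indicates that [y] covers [w], and S1, S2, S3
    count the paths for UUD, UDU and DUU. *)
Lemma solve_cross_identity (C : fieldType) (x E B k S1 S2 S3 : C) : x != 0 ->
  (x + 1) * S2 * E = (x + 1) * (B * k) + E * (x * S1 + S3) ->
  E * S3 = x * (x + 1) * (x^-1 * E * S2) - x ^+ 3 * (x ^- 2 * E * S1) - B * (x + 1) * k.
Proof.
move=> x0 e; transitivity ((x + 1) * S2 * E - (x + 1) * (B * k) - E * (x * S1)).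
  by rewrite e; ring.
by field.
Qed.

(** * Realisation by matrices indexed by the poset *)

Section Matrices.

Variables (R : realType) (F : finFieldType) (H : vectType F) (h : {vspace H}).
Implicit Types (y z u v w : attenuated h).
Notation q := (#|F|%:R : R[i]).

Lemma mat_of_mul (f g : attenuated h -> attenuated h -> R[i]) :
  mat_of f *m mat_of g = mat_of (fun y z => \sum_u f y u * g u z).
Proof.
apply/matrixP => i j; rewrite !mxE [RHS](reindex (@enum_val _ (attenuated h))) /=.
  by apply: eq_bigr => k _; rewrite !mxE.
exact: onW_bij (enum_val_bij (attenuated h)).
Qed.

Lemma mat_of_mul3 (f g k : attenuated h -> attenuated h -> R[i]) :
  mat_of f *m mat_of g *m mat_of k
  = mat_of (fun y z => \sum_v \sum_u f y u * g u v * k v z).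
Proof.
rewrite !mat_of_mul; apply/matrixP => i j; rewrite !mxE.
by apply: eq_bigr => v _; rewrite big_distrl.
Qed.

Definition diag_of (f : attenuated h -> R[i]) : matX R h :=
  mat_of (fun y z => if y == z then f y else 0).

Lemma diag_of_mull (f : attenuated h -> R[i]) g :
  diag_of f *m mat_of g = mat_of (fun y z => f y * g y z).
Proof.
rewrite mat_of_mul; apply/matrixP => i j; rewrite !mxE.
rewrite (bigD1 (enum_val i)) //= eqxx big1 ?addr0 // => u /negPf.
by rewrite eq_sym => ->; rewrite mul0r.
Qed.

Lemma diag_of_mulr (f : attenuated h -> R[i]) g :
  mat_of g *m diag_of f = mat_of (fun y z => g y z * f z).
Proof.
rewrite mat_of_mul; apply/matrixP => i j; rewrite !mxE.
by rewrite (bigD1 (enum_val j)) //= eqxx big1 ?addr0 // => u /negPf ->; rewrite mulr0.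
Qed.

(** [lowering] is U and [raising] is D; the names describe the action on row vectors. *)
Definition lowering : matX R h := mat_of (fun y z => (covers y z)%:R).
Definition raising : matX R h := mat_of (fun y z => (covers z y)%:R * q ^+ att_dim y).

Lemma card_field_neq0 : q != 0.
Proof. by rewrite Num.Theory.pnatr_eq0 -lt0n ltnW // card_finNzRing_gt1. Qed.

Lemma att_dim_covers z y : covers z y -> att_dim z = (att_dim y).+1.
Proof. exact: covers_dim. Qed.

Lemma attA_sum : attA R h = lowering + raising.
Proof.
apply/matrixP => i j; rewrite !mxE; set y := enum_val i; set z := enum_val j.
case yz: (covers y z); case zy: (covers z y); rewrite ?mul0r ?mul1r ?addr0 ?add0r //.
by have := covers_dim yz; rewrite (covers_dim zy); lia.
Qed.

Lemma attAstarE : attAstar R h = diag_of (fun y => q ^- att_dim y).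
Proof. by []. Qed.

Lemma lowering_attAstar : lowering *m attAstar R h = q *: (attAstar R h *m lowering).
Proof.
rewrite attAstarE diag_of_mulr diag_of_mull; apply/matrixP => i j; rewrite !mxE.
case yz: (covers _ _); last by rewrite mul0r !mulr0.
by rewrite (att_dim_covers yz) exprS invfM mul1r mulr1 mulVKf // card_field_neq0.
Qed.

Lemma raising_attAstar : raising *m attAstar R h = q^-1 *: (attAstar R h *m raising).
Proof.
rewrite attAstarE diag_of_mulr diag_of_mull; apply/matrixP => i j; rewrite !mxE.
case yz: (covers _ _); last by rewrite !mul0r !mulr0.
by rewrite (att_dim_covers yz) exprS invfM mul1r mulrCA [_ * q ^- _]mulrC.
Qed.

(** The diagonal of [attAstar] cancels the row weights of [raising]. *)
Lemma trmx_lowering : lowering^T = attAstar R h *m raising.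
Proof.
rewrite attAstarE diag_of_mull; apply/matrixP => i j; rewrite !mxE.
by rewrite mulrCA mulVf ?mulr1 // expf_neq0 // card_field_neq0.
Qed.

Lemma mul_diag_attAstar : diag_of (fun y => q ^+ att_dim y) *m attAstar R h = 1%:M.
Proof.
rewrite diag_of_mull; apply/matrixP => i j; rewrite !mxE (inj_eq enum_val_inj).
by case: eqP; rewrite ?mulr0 // mulfV // expf_neq0 // card_field_neq0.
Qed.

Lemma tr_diag_of (f : attenuated h -> R[i]) : (diag_of f)^T = diag_of f.
Proof. by apply/matrixP => i j; rewrite !mxE eq_sym; case: eqP => // ->. Qed.

(** The weight in each word is q to the dimension of the row index of its [raising] factor: dim y in
    DUU, dim y - 1 in UDU, dim y - 2 in UUD. The hypothesis expresses c = q^(dim H - 2) without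
    subtraction. *)
Lemma raising_lowering_lowering (c : R[i]) : q ^+ 2 * c = q ^+ \dim {: H} ->
  raising *m lowering *m lowering
  = (q * (q + 1)) *: (lowering *m raising *m lowering)
    - q ^+ 3 *: (lowering *m lowering *m raising) - (q ^+ 2 * c * (q + 1)) *: lowering.
Proof.
move=> ->; rewrite !mat_of_mul3; apply/matrixP => i j; rewrite !mxE.
set y := enum_val i; set w := enum_val j.
have q0 := card_field_neq0.
have -> : \sum_v \sum_u (covers u y)%:R * q ^+ att_dim y * (covers u v)%:R * (covers v w)%:R
    = q ^+ att_dim y * (\sum_v \sum_u covers u y * covers u v * covers v w)%:R.
  rewrite natr_sum mulr_sumr; apply: eq_bigr => v _.
  rewrite natr_sum mulr_sumr; apply: eq_bigr => u _.
  by rewrite !natrM [_%:R * q ^+ _]mulrC -!mulrA.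
have -> : \sum_v \sum_u (covers y u)%:R * (covers u v)%:R * ((covers w v)%:R * q ^+ att_dim v)
    = q ^- 2 * q ^+ att_dim y * (\sum_v \sum_u covers y u * covers u v * covers w v)%:R.
  rewrite natr_sum mulr_sumr; apply: eq_bigr => v _.
  rewrite natr_sum mulr_sumr; apply: eq_bigr => u _.
  case yu: (covers y u); last by rewrite !mul0r mulr0.
  case uv: (covers u v); last by rewrite mulr0 mul0r mulr0.
  rewrite (att_dim_covers yu) (att_dim_covers uv) !natrM -[(_ v).+2]add2n exprD.
  by rewrite mulKf ?expf_neq0 // !mul1r mulrC.
have -> : \sum_v \sum_u (covers y u)%:R * ((covers v u)%:R * q ^+ att_dim u) * (covers v w)%:R
    = q^-1 * q ^+ att_dim y * (\sum_v \sum_u covers y u * covers v u * covers v w)%:R.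
  rewrite natr_sum mulr_sumr; apply: eq_bigr => v _.
  rewrite natr_sum mulr_sumr; apply: eq_bigr => u _.
  case yu: (covers y u); last by rewrite !mul0r mulr0.
  rewrite (att_dim_covers yu) !natrM exprS mulKf // !mul1r.
  by rewrite [_%:R * q ^+ _]mulrC -mulrA.
have := congr1 (fun n => n%:R : R[i]) (cross_identity y w).
rewrite natrD !natrM natrD natrM !natrX -addn1 natrD.
exact: solve_cross_identity q0.
Qed.

End Matrices.

Theorem proposition8p6 (R : realType) (F : finFieldType) (N M : nat)
    (H : vectType F) (h : {vspace H}) :
  (0 < N)%N -> (0 < M)%N -> \dim {:H} = (N + M)%N -> \dim h = M ->
  let q : R[i] := #|F|%:R in
  let beta : R[i] := q + q^-1 in
  let A : matX R h := attA R h in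
  let As : matX R h := attAstar R h in
  A ^+ 3 * As - (beta + 1) *: (A ^+ 2 * As * A)
    + (beta + 1) *: (A * As * A ^+ 2) - As * A ^+ 3
    = (q ^+ (N + M - 2) * (q + 1) ^+ 2) *: (A * As - As * A)
  /\
  As ^+ 2 * A - beta *: (As * A * As) + A * As ^+ 2 = 0.
Proof.
move=> N0 M0 dH dh q beta A As.
have q0 : q != 0 := card_field_neq0 R F.
have UK := lowering_attAstar R h.
have DK := raising_attAstar R h.
rewrite !exprS expr0 !mulr1 /A /As attA_sum -!mulmxE !mulmxA; split.
  apply: (tridiagonal_sum q0 UK DK (mul_diag_attAstar R h) (trmx_lowering R h)) => //.
    exact: tr_diag_of.
  (* Here c is q^(N+M-2); positivity of N and M gives 2 <= N + M, so the exponent is not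
     truncated. *)
  by apply: raising_lowering_lowering; rewrite -exprD subnKC ?dH //; lia.
exact: quadratic_sum q0 UK DK.
Qed.
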